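(* Let $\varphi:\mathbb{R}^2\to\mathbb{R}$ be a conewise linear function. Then the canonical representation of $\varphi$ is minimal with respect to monomial complexity $\mathrm{mComp}$.
   Context: Tropical operations: $a\oplus b=\max\{a,b\}$, $a\odot b=a+b$, $a\oslash b=a-b$. A tropical polynomial on $\mathbb{R}^d$ is a function $g(x)=\max_{1\le i\le n}(\langle b_i,x\rangle+a_i)$ with $a_i\in\mathbb{R}$ and arbitrary exponents $b_i\in\mathbb{R}^d$. A tropical rational function (equivalently a continuous piecewise-linear function with finitely many pieces) is $\varphi=g\oslash h=g-h$ with $g,h$ tropical polynomials; the pair $(g,h)$ is called a representation of $\varphi$. ''Linear'' means affine-linear. A function is conewise linear if there are a point $\tau$ and finitely many polyhedral cones with common apex $\tau$ covering the space, such that the (continuous) function is linear on each cone. $\mathrm{mComp}(g)$ is the number of linear regions of the tropical polynomial $g$, i.e. the number of connected components of $\mathbb{R}^d\setminus\mathcal{V}(g)$, where $\mathcal{V}(\varphi)=\{x:\varphi\text{ is not linear in any neighbourhood of }x\}$. $\mathcal{V}(\varphi)$ is a pure $(d-1)$-dimensional polyhedral complex with weights: if the $(d-1)$-face $\sigma$ separates linear regions with gradients $u_1,u_2$, then $w_\varphi(\sigma)=\|u_1-u_2\|$ if $\varphi$ is locally convex along $\sigma$ and $-\|u_1-u_2\|$ if $\varphi$ is locally concave along $\sigma$. $\mathcal{V}(\varphi)_+$ (resp. $\mathcal{V}(\varphi)_-$) is the subcomplex of faces of positive (resp. negative) weight, i.e. the closure of the set of points near which $\varphi$ is strictly (i.e.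 non-linearly) convex (resp. concave), with weights $|w_\varphi|$. For a tropical polynomial $g$, $\mathcal{V}(g)$ with its weights determines $g$ up to addition of a linear function, and a nonnegatively weighted pure $(d-1)$-dimensional complex is of the form $\mathcal{V}(g)$ iff it is balanced. Canonical representation: let $\varphi:\mathbb{R}^2\to\mathbb{R}$ be conewise linear with apex $\tau$. $\mathcal{V}(\varphi)_+$ consists of rays $\gamma_1,\dots,\gamma_n$ from $\tau$; let $v_i$ be the vector generating $\gamma_i$ whose norm is the weight of $\gamma_i$ in $\mathcal{V}(\varphi)_+$. Put $v_{n+1}=-\sum_{i=1}^n v_i$. If $v_{n+1}\ne0$ let $\gamma_{n+1}$ be the ray from $\tau$ generated by $v_{n+1}$ with weight $\|v_{n+1}\|$; if $v_{n+1}=0$ let $\gamma_{n+1}$ be empty. Let $X$ be the weighted complex consisting of $\mathcal{V}(\varphi)_+$ and $\gamma_{n+1}$, and $Y$ the one consisting of $\mathcal{V}(\varphi)_-$ and $\gamma_{n+1}$ (weights add where rays coincide). Both are balanced (the weighted sum of unit generators of the rays is $0$), so there are tropical polynomials $g,h$ with $\mathcal{V}(g)=X$, $\mathcal{V}(h)=Y$ and $\varphi=g\oslash h$ (unique up to adding the same linear function to $g$ and $h$). This $g\oslash h$ is the canonical representation of $\varphi$. Minimality: on representations of $\varphi$ put the preorder $g_1\oslash h_1\prec g_2\oslash h_2$ iff $\mathrm{mComp}(g_1)\le\mathrm{mComp}(g_2)$ and $\mathrm{mComp}(h_1)\le\mathrm{mComp}(h_2)$. A representation $g\oslash h$ is minimal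 if there is no representation $g'\oslash h'$ of $\varphi$ with $\mathrm{mComp}(g')\le\mathrm{mComp}(g)$ and $\mathrm{mComp}(h')\le\mathrm{mComp}(h)$ in which at least one inequality is strict. *)

(* Defs.v *)
From HB Require Import structures.
From mathcomp Require Import all_boot all_order all_algebra finmap.
From mathcomp Require Import all_classical all_reals all_analysis.

Set Implicit Arguments.
Unset Strict Implicit.
Unset Printing Implicit Defensive.

Import Order.TTheory GRing.Theory Num.Theory.
Import numFieldNormedType.Exports.

Local Open Scope classical_set_scope.
Local Open Scope ring_scope.

Definition dot (R : realType) (d : nat) (u v : 'rV[R]_d) : R :=
  \sum_(i < d) u 0 i * v 0 i.

(* The library norm on 'rV[R]_d is the sup norm; weights use the Euclidean
   one. *)
Definition enorm (R : realType) (d : nat) (u : 'rV[R]_d) : R :=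
  Num.sqrt (dot u u).

(* The maximum runs over the nonempty index set 'I_n.+1; the default value of
   the iterated maximum is its term of index 0. *)
Definition tropical_polynomial (R : realType) (d : nat)
    (g : 'rV[R]_d -> R) : Prop :=
  exists (n : nat) (a : 'I_n.+1 -> R) (b : 'I_n.+1 -> 'rV[R]_d),
    forall x, g x = \big[Num.max/dot (b ord0) x + a ord0]_(i < n.+1)
                      (dot (b i) x + a i).

Definition representation (R : realType) (d : nat)
    (phi g h : 'rV[R]_d -> R) : Prop :=
  [/\ tropical_polynomial g, tropical_polynomial h
    & forall x, phi x = g x - h x].

Definition nonlinear_locus (R : realType) (d : nat) (phi : 'rV[R]_d -> R) :
    set 'rV[R]_d :=
  [set x | ~ exists (u : 'rV[R]_d) (c : R),
                \forall y \near x, phi y = dot u y + c].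

Definition linear_regions (R : realType) (d : nat) (phi : 'rV[R]_d -> R) :
    set (set 'rV[R]_d) :=
  [set connected_component (~` nonlinear_locus phi) x
     | x in ~` nonlinear_locus phi].

(* [fset_set] is meaningful on finite sets only; a tropical polynomial has
   finitely many linear regions. *)
Definition mComp (R : realType) (d : nat) (g : 'rV[R]_d -> R) : nat :=
  #|` fset_set (linear_regions g)|.

Definition minimal_representation (R : realType) (d : nat)
    (phi g h : 'rV[R]_d -> R) : Prop :=
  representation phi g h /\
  ~ exists g' h' : 'rV[R]_d -> R,
      [/\ representation phi g' h',
          (mComp g' <= mComp g)%N, (mComp h' <= mComp h)%N
        & (mComp g' < mComp g)%N \/ (mComp h' < mComp h)%N].

Definition polyhedral_cone (R : realType) (d : nat) (tau : 'rV[R]_d)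
    (C : set 'rV[R]_d) : Prop :=
  exists (m : nat) (n : 'I_m -> 'rV[R]_d),
    C = [set x | forall i, 0 <= dot (n i) (x - tau)].

Definition conewise_linear (R : realType) (d : nat) (tau : 'rV[R]_d)
    (phi : 'rV[R]_d -> R) : Prop :=
  continuous phi /\
  exists (k : nat) (C : 'I_k -> set 'rV[R]_d),
    [/\ forall i, polyhedral_cone tau (C i),
        \bigcup_i C i = setT
      & forall i, exists (u : 'rV[R]_d) (c : R),
          {in C i, forall x, phi x = dot u x + c}].

Definition locally_convex (R : realType) (d : nat) (phi : 'rV[R]_d -> R)
    (x : 'rV[R]_d) : Prop :=
  exists2 e : R, 0 < e & convex_function (ball x e) phi.

(* x lies in the relative interior of a (d-1)-face of the locus, contained in
   the hyperplane through x orthogonal to nu; u1 and u2 are the gradients on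
   the two sides. *)
Definition separates (R : realType) (d : nat) (phi : 'rV[R]_d -> R)
    (x u1 u2 : 'rV[R]_d) : Prop :=
  u1 <> u2 /\
  exists2 nu : 'rV[R]_d, nu != 0 &
    \forall y \near x,
      (0 <= dot nu (y - x) -> phi y = phi x + dot u1 (y - x)) /\
      (dot nu (y - x) <= 0 -> phi y = phi x + dot u2 (y - x)).

Definition is_weight (R : realType) (d : nat) (phi : 'rV[R]_d -> R)
    (x : 'rV[R]_d) (w : R) : Prop :=
  exists u1 u2 : 'rV[R]_d, separates phi x u1 u2 /\
    (locally_convex phi x /\ w = enorm (u1 - u2) \/
     locally_convex (fun y => - phi y) x /\ w = - enorm (u1 - u2)).

(* The weight of a face is read off at the points of its relative interior;
   it is set to 0 at the other points. *)
Definition weight (R : realType) (d : nat) (phi : 'rV[R]_d -> R)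
    (x : 'rV[R]_d) : R :=
  xget 0 [set w | is_weight phi x w].

Definition positive_part (R : realType) (d : nat) (phi : 'rV[R]_d -> R) :
    set 'rV[R]_d :=
  closure [set x | 0 < weight phi x].

Definition negative_part (R : realType) (d : nat) (phi : 'rV[R]_d -> R) :
    set 'rV[R]_d :=
  closure [set x | weight phi x < 0].

Definition ray (R : realType) (d : nat) (tau v : 'rV[R]_d) : set 'rV[R]_d :=
  [set tau + t *: v | t in [set t : R | 0 <= t]].

(* A sequence vs of nonzero vectors encodes the weighted complex formed by the
   rays from tau generated by its elements, the weight of a ray being the norm
   of its generator; weights add where rays coincide. The weighted complex to
   be compared with it has support S and weight W x at the points x <> tau. *)
Definition weighted_rays (R : realType) (d : nat) (tau : 'rV[R]_d)
    (vs : seq 'rV[R]_d) (S : set 'rV[R]_d) (W : 'rV[R]_d -> R) : Prop :=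
  [/\ 0 \notin vs,
      S = [set x | exists2 v, v \in vs & ray tau v x]
    & forall x, S x -> x <> tau ->
        W x = \sum_(v <- vs | `[< ray tau v x >]) enorm v].

(* vs and ws generate the rays of the positive and of the negative part of
   phi; extra is the ray added to balance the positive part, if any. *)
Definition canonical_representation (R : realType) (tau : 'rV[R]_2)
    (phi g h : 'rV[R]_2 -> R) : Prop :=
  representation phi g h /\
  exists vs ws : seq 'rV[R]_2,
    let v0 := - \sum_(v <- vs) v in
    let extra := if v0 == 0 then [::] else [:: v0] in
    [/\ uniq [seq ray tau v | v <- vs] /\
          weighted_rays tau vs (positive_part phi) (fun x => `|weight phi x|),
        uniq [seq ray tau v | v <- ws] /\
          weighted_rays tau ws (negative_part phi) (fun x => `|weight phi x|),
        weighted_rays tau (vs ++ extra) (nonlinear_locus g) (weight g)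
      & weighted_rays tau (ws ++ extra) (nonlinear_locus h) (weight h)].

(* Main.v *)
Require Import Defs.
From HB Require Import structures.
From mathcomp Require Import all_boot all_order all_algebra finmap.
From mathcomp Require Import all_classical all_reals all_analysis.
From mathcomp Require Import ring lra.

(* The number of regions of a tropical polynomial is its number of distinct
   gradients. The exponents active at tau are the vertices of a polygon whose
   edges are dual to the rays issued from tau in the locus; there are as many
   rays as vertices, unless there is a single vertex, and the rays, weighted by
   the jump of the gradient across them, are balanced. The jumps of g - h only
   depend on phi.
   If phi = g' - h' and g' has fewer regions than the canonical g, then g must
   have the balancing ray v0 besides the rays of phi_+, and the rays of g' at
   tau are exactly those of phi_+. Comparing the balancing conditions of g and
   g', the excess of the weights of g' over those of phi_+ sums up to v0. This
   excess is also carried by h'; as v0 is not on a ray of phi_+, at least two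
   rays are involved, and h' has at least two rays more than phi_-, hence more
   regions than h. The case where h' has fewer regions than h is symmetric. *)

Set Implicit Arguments.
Unset Strict Implicit.
Unset Printing Implicit Defensive.

Import Order.TTheory GRing.Theory Num.Theory.
Import numFieldNormedType.Exports.

Local Open Scope classical_set_scope.
Local Open Scope ring_scope.

(** * Support functions of finite planar sets *)

Lemma dotC (R : realType) d (u v : 'rV[R]_d) : dot u v = dot v u.
Proof. by apply: eq_bigr => i _; rewrite mulrC. Qed.

Lemma dotDl (R : realType) d (u v w : 'rV[R]_d) :
  dot (u + v) w = dot u w + dot v w.
Proof. by rewrite -big_split; apply: eq_bigr => i _; rewrite mxE mulrDl. Qed.

Lemma dotZl (R : realType) d (c : R) (u v : 'rV[R]_d) :
  dot (c *: u) v = c * dot u v.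
Proof. by rewrite /dot mulr_sumr; apply: eq_bigr => i _; rewrite mxE mulrA. Qed.

Lemma dotDr (R : realType) d (u v w : 'rV[R]_d) :
  dot u (v + w) = dot u v + dot u w.
Proof. by rewrite dotC dotDl !(dotC u). Qed.

Lemma dotZr (R : realType) d (c : R) (u v : 'rV[R]_d) :
  dot u (c *: v) = c * dot u v.
Proof. by rewrite dotC dotZl dotC. Qed.

Lemma dotNl (R : realType) d (u v : 'rV[R]_d) : dot (- u) v = - dot u v.
Proof. by rewrite -scaleN1r dotZl mulN1r. Qed.

Lemma dotNr (R : realType) d (u v : 'rV[R]_d) : dot u (- v) = - dot u v.
Proof. by rewrite dotC dotNl dotC. Qed.

Lemma dotBl (R : realType) d (u v w : 'rV[R]_d) :
  dot (u - v) w = dot u w - dot v w.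
Proof. by rewrite dotDl dotNl. Qed.

Lemma dotBr (R : realType) d (u v w : 'rV[R]_d) :
  dot u (v - w) = dot u v - dot u w.
Proof. by rewrite dotDr dotNr. Qed.

Lemma dot0l (R : realType) d (u : 'rV[R]_d) : dot 0 u = 0.
Proof. by rewrite -(scale0r 0) dotZl mul0r. Qed.

Lemma dot_gt0 (R : realType) d (u : 'rV[R]_d) : u != 0 -> 0 < dot u u.
Proof.
move=> u0; rewrite lt0r; apply/andP; split; last first.
  by apply: sumr_ge0 => i _; rewrite -expr2 sqr_ge0.
apply: contra u0; rewrite psumr_eq0; last by move=> i _; rewrite -expr2 sqr_ge0.
move/allP => u0; apply/eqP/rowP => i; rewrite mxE.
have := u0 i; rewrite mem_index_enum => /(_ isT) /=.
by rewrite mulf_eq0 orbb => /eqP.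
Qed.

Lemma dot_separating (R : realType) d (w : 'rV[R]_d) :
  (forall z, dot w z = 0) -> w = 0.
Proof.
move=> w0; apply/eqP; apply: contraT => /dot_gt0.
by rewrite w0 ltxx.
Qed.

(* For [s = 1] this is the counterclockwise rotation by a right angle, for
   [s = -1] the clockwise one. *)
Definition rot (R : realType) (s : R) (r : 'rV[R]_2) : 'rV[R]_2 :=
  \row_i (if i == 0 then - s * r 0 1 else s * r 0 0).

Lemma dot2E (R : realType) (u v : 'rV[R]_2) :
  dot u v = u 0 0 * v 0 0 + u 0 1 * v 0 1.
Proof.
rewrite /dot big_ord_recl big_ord1.
by congr (_ + u _ _ * v _ _); exact: val_inj.
Qed.

Lemma rotE0 (R : realType) (s : R) (r : 'rV[R]_2) : rot s r 0 0 = - s * r 0 1.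
Proof. by rewrite mxE. Qed.

Lemma rotE1 (R : realType) (s : R) (r : 'rV[R]_2) : rot s r 0 1 = s * r 0 0.
Proof. by rewrite mxE. Qed.

Lemma rotZ (R : realType) (s c : R) (r : 'rV[R]_2) :
  rot s (c *: r) = c *: rot s r.
Proof. by apply/rowP => i; rewrite !mxE; case: ifP => _; ring. Qed.

Lemma rotN (R : realType) (s : R) (r : 'rV[R]_2) : rot (- s) r = - rot s r.
Proof. by apply/rowP => i; rewrite !mxE; case: ifP => _; ring. Qed.

Lemma dot_rot (R : realType) (s : R) (r : 'rV[R]_2) : dot r (rot s r) = 0.
Proof. by rewrite dot2E rotE0 rotE1; ring. Qed.

Lemma rot_rot (R : realType) (s : R) (r : 'rV[R]_2) :
  rot s (rot s r) = - (s ^+ 2 *: r).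
Proof.
have e i : i = 0 \/ i = 1 :> 'I_2.
  by case: i => -[|[|//]] i; [left|right]; exact: val_inj.
by apply/rowP => i; rewrite !mxE; case: (e i) => -> /=; ring.
Qed.

(** Parseval's identity in the orthogonal basis [r], [rot s r], whose squared norms are [dot r r]
    and [s ^+ 2 * dot r r]. It is cleared of denominators so that signs can be compared without
    dividing. *)
Lemma frameE (R : realType) (s : R) (r w z : 'rV[R]_2) :
  s ^+ 2 * dot r r * dot w z =
  s ^+ 2 * (dot w r * dot z r) + dot w (rot s r) * dot z (rot s r).
Proof. by rewrite !dot2E !rotE0 !rotE1; ring. Qed.

Lemma frame_expand (R : realType) (s : R) (r z : 'rV[R]_2) :
  (s ^+ 2 * dot r r) *: z =
  (s ^+ 2 * dot z r) *: r + dot z (rot s r) *: rot s r.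
Proof.
apply/eqP; rewrite -subr_eq0; apply/eqP/dot_separating => w.
by rewrite dotBl dotDl !dotZl dotC frameE !(dotC w); ring.
Qed.

Lemma frame_gt0 (R : realType) (s : R) (r : 'rV[R]_2) :
  s != 0 -> r != 0 -> 0 < s ^+ 2 * dot r r.
Proof. by move=> s0 r0; rewrite mulr_gt0 ?dot_gt0// exprn_even_gt0. Qed.

Lemma frame_eq0 (R : realType) (s : R) (r w : 'rV[R]_2) : s != 0 -> r != 0 ->
  dot w r = 0 -> dot w (rot s r) = 0 -> w = 0.
Proof.
move=> s0 r0 wr wq; apply/eqP.
have /eqP := frame_expand s r w; rewrite wr wq mulr0 !scale0r addr0.
by rewrite scaler_eq0 gt_eqF ?frame_gt0.
Qed.

Definition same_ray (R : realType) d (v w : 'rV[R]_d) : Prop :=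
  exists2 c : R, 0 < c & w = c *: v.

Lemma same_ray_sym (R : realType) d (v w : 'rV[R]_d) :
  same_ray v w -> same_ray w v.
Proof.
move=> [c c0 ->]; exists c^-1; first by rewrite invr_gt0.
by rewrite scalerA mulVf ?scale1r// gt_eqF.
Qed.

Lemma same_ray_trans (R : realType) d (u v w : 'rV[R]_d) :
  same_ray u v -> same_ray v w -> same_ray u w.
Proof.
move=> [c c0 ->] [e e0 ->]; exists (e * c); first by rewrite mulr_gt0.
by rewrite scalerA.
Qed.

(** Maximality in the direction [r + e *: q] for infinitesimal [e > 0]: [q] only breaks the ties
    left by [r]. *)
Definition lexmax (R : realType) (B : seq 'rV[R]_2) (r q u : 'rV[R]_2) : Prop :=
  u \in B /\ forall b, b \in B ->
    dot b r < dot u r \/ dot b r = dot u r /\ dot b q <= dot u q.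

(* The gradient, next to the ray generated by r, of the support function of B;
   the sign of s tells on which side of the ray. *)
Definition vertex (R : realType) (B : seq 'rV[R]_2) (s : R) (r : 'rV[R]_2) :
    'rV[R]_2 :=
  xget 0 [set u | lexmax B r (rot s r) u].

Lemma lexmax_exists (R : realType) (B : seq 'rV[R]_2) (r q : 'rV[R]_2) :
  B != [::] -> exists u, lexmax B r q u.
Proof.
elim: B => [//|b [_ _|c B IH _]].
  by exists b; split; rewrite ?mem_head// => ? /[!inE] /eqP ->; right.
have [//|u [uB um]] := IH.
have [h|h] := pselect (dot b r < dot u r \/ dot b r = dot u r /\ dot b q <= dot u q).
  exists u; split=> [|x]; first by rewrite in_cons uB orbT.
  by rewrite in_cons => /orP[/eqP ->//|/um].
exists b; split=> [|x]; first by rewrite mem_head.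
rewrite in_cons => /orP[/eqP ->|/um xu]; first by right.
have {}h : dot u r < dot b r \/ dot u r = dot b r /\ dot u q < dot b q.
  case: (ltgtP (dot u r) (dot b r)) => e; [by left|by case: h; left|right; split=> //].
  by rewrite ltNge; apply/negP => h'; apply: h; right.
by lra.
Qed.

(** Two maximisers have equal products with [r] and [rot s r], which form a basis. *)
Lemma lexmax_unique (R : realType) (B : seq 'rV[R]_2) (s : R)
    (r u v : 'rV[R]_2) : s != 0 -> r != 0 ->
  lexmax B r (rot s r) u -> lexmax B r (rot s r) v -> u = v.
Proof.
move=> s0 r0 [uB um] [vB vm].
have h1 := um _ vB; have h2 := vm _ uB.
by apply/eqP; rewrite -subr_eq0; apply/eqP/(frame_eq0 s0 r0); rewrite dotBl; lra.
Qed.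

Lemma vertexP (R : realType) (B : seq 'rV[R]_2) (s : R) (r : 'rV[R]_2) :
  B != [::] -> lexmax B r (rot s r) (vertex B s r).
Proof.
move=> /(lexmax_exists r (rot s r)) [u hu].
by rewrite /vertex; exact: (xgetPex _ (ex_intro _ u hu)).
Qed.

Lemma lexmax_vertex (R : realType) (B : seq 'rV[R]_2) (s : R)
    (r u : 'rV[R]_2) : s != 0 -> r != 0 ->
  lexmax B r (rot s r) u -> vertex B s r = u.
Proof.
move=> s0 r0 hu; apply: (lexmax_unique s0 r0 _ hu); apply: vertexP.
by case: hu; case: B.
Qed.

Lemma vertexZ (R : realType) (B : seq 'rV[R]_2) (s c : R) (r : 'rV[R]_2) :
  B != [::] -> s != 0 -> r != 0 -> 0 < c ->
  vertex B s (c *: r) = vertex B s r.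
Proof.
move=> B0 s0 r0 c0; apply: lexmax_vertex => //.
  by rewrite scaler_eq0 negb_or r0 gt_eqF.
have [uB um] := vertexP s r B0; split=> // b /um.
rewrite rotZ !dotZr => -[h|[-> h]]; [left|right; split=> //].
  by rewrite ltr_pM2l.
by rewrite ler_pM2l.
Qed.

(* Up to the factor |r|, the weight of the ray generated by r. *)
Definition jump (R : realType) (B : seq 'rV[R]_2) (r : 'rV[R]_2) : R :=
  dot (vertex B 1 r - vertex B (-1) r) (rot 1 r).

Lemma vertex_ray (R : realType) (B : seq 'rV[R]_2) (s s' : R) (r : 'rV[R]_2) :
  B != [::] -> dot (vertex B s r) r = dot (vertex B s' r) r.
Proof.
move=> B0; have [uB um] := vertexP s r B0; have [vB vm] := vertexP s' r B0.
by have := um _ vB; have := vm _ uB; lra.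
Qed.

Lemma jumpE (R : realType) (B : seq 'rV[R]_2) (r : 'rV[R]_2) : B != [::] ->
  dot r r *: (vertex B 1 r - vertex B (-1) r) = jump B r *: rot 1 r.
Proof.
move=> B0; have := frame_expand 1 r (vertex B 1 r - vertex B (-1) r).
rewrite dotBl (vertex_ray 1 (-1) r B0) subrr mulr0 scale0r add0r.
by rewrite expr1n mul1r.
Qed.

Lemma jump_ge0 (R : realType) (B : seq 'rV[R]_2) (r : 'rV[R]_2) :
  B != [::] -> 0 <= jump B r.
Proof.
move=> B0; have [uB um] := vertexP 1 r B0; have [vB vm] := vertexP (-1) r B0.
have := um _ vB; have := vm _ uB; rewrite /jump dotBl rotN !dotNr; lra.
Qed.

Lemma jump_eq0 (R : realType) (B : seq 'rV[R]_2) (r : 'rV[R]_2) :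
  B != [::] -> r != 0 ->
  jump B r = 0 <-> vertex B 1 r = vertex B (-1) r.
Proof.
move=> B0 r0; split=> [h|e]; last by rewrite /jump e subrr dot0l.
have /eqP := jumpE r B0; rewrite h scale0r scaler_eq0 gt_eqF ?dot_gt0//=.
by rewrite subr_eq0 => /eqP.
Qed.

Lemma jumpZ (R : realType) (B : seq 'rV[R]_2) (c : R) (v : 'rV[R]_2) :
  B != [::] -> v != 0 -> 0 < c -> jump B (c *: v) = c * jump B v.
Proof.
move=> B0 v0 c0; rewrite /jump !vertexZ// ?oppr_eq0 ?oner_eq0//.
by rewrite rotZ dotZr.
Qed.

(* The closed cone on which the support function of B is given by u is convex,
   hence has at most one boundary ray on each side. *)
Lemma vertex_inj (R : realType) (B : seq 'rV[R]_2) (s : R) (r r' : 'rV[R]_2) :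
  B != [::] -> s != 0 -> r != 0 -> r' != 0 ->
  vertex B s r != vertex B (- s) r -> vertex B s r' != vertex B (- s) r' ->
  vertex B s r = vertex B s r' -> same_ray r r'.
Proof.
move=> B0 s0 r0 r0'.
(* It suffices that [r'] lies on the ray of [r] or strictly on its [s] side: the same holds with [r]
   and [r'] exchanged, and [dot r (rot s r')] is opposite to [dot r' (rot s r)]. *)
wlog suff main : r r' r0 r0' /
    vertex B s r != vertex B (- s) r -> vertex B s r = vertex B s r' ->
    same_ray r r' \/ 0 < dot r' (rot s r).
  move=> k k' e.
  have [//|h] := main _ _ r0 r0' k e.
  have [/same_ray_sym//|] := main _ _ r0' r0 k' (esym e).
  by move: h; rewrite !dot2E !rotE0 !rotE1; lra.
move=> k e.
set u := vertex B s r in k e; set v := vertex B (- s) r in k.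
have [uB um] := vertexP s r B0; rewrite -/u in uB um.
have [vB vm] := vertexP (- s) r B0; rewrite -/v in vB vm.
have dr : dot (v - u) r = 0 by rewrite dotBl (vertex_ray (- s) s) ?subrr.
(* So [v - u] is a negative multiple of [rot s r], and a direction in which [v] does not beat [u]
   has a nonnegative coordinate along [rot s r]. *)
have dq : dot (v - u) (rot s r) < 0.
  rewrite lt_neqAle; apply/andP; split.
    apply: contra k => /eqP/(frame_eq0 s0 r0 dr)/eqP.
    by rewrite subr_eq0 eq_sym.
  by move: dr (um _ vB); rewrite !dotBl; lra.
have [_ /(_ _ vB)] := vertexP s r' B0; rewrite -e => h.
have {}h : dot (v - u) r' < 0 \/ dot (v - u) r' = 0 /\ dot (v - u) (rot s r') <= 0.
  by rewrite !dotBl; lra.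
have f := frame_gt0 s0 r0.
have e1 := frameE s r (v - u) r'.
have e2 := frameE s r (v - u) (rot s r').
rewrite dr mul0r mulr0 add0r in e1; rewrite dr mul0r mulr0 add0r in e2.
case: h => [h|[h1 h2]].
  right; have : dot (v - u) (rot s r) * dot r' (rot s r) < 0.
    by rewrite -e1 pmulr_rlt0.
  by rewrite nmulr_rlt0.
(* Here [r'] is collinear with [r], and the tie-breaking inequality shows that it points the same
   way. *)
left; move: e1; rewrite h1 mulr0 => /esym/eqP; rewrite mulf_eq0 lt_eqF//=.
move=> /eqP p0.
have c0 : 0 <= dot r' r.
  have : dot (v - u) (rot s r) * dot (rot s r') (rot s r) <= 0.
    by rewrite -e2 pmulr_rle0.
  rewrite nmulr_rle0//.
  have -> : dot (rot s r') (rot s r) = s ^+ 2 * dot r' r.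
    by rewrite !dot2E !rotE0 !rotE1; ring.
  by rewrite pmulr_rge0// exprn_even_gt0.
have := frame_expand s r r'; rewrite p0 scale0r addr0 => e3.
have r'E : r' = (dot r' r / dot r r) *: r.
  apply: (scalerI (lt0r_neq0 f)); rewrite e3 scalerA.
  congr (_ *: _); field; exact: lt0r_neq0 (dot_gt0 r0).
exists (dot r' r / dot r r) => //; rewrite lt0r; apply/andP; split.
  by apply: contra r0' => /eqP k0; rewrite r'E k0 scale0r.
by rewrite divr_ge0// ltW// dot_gt0.
Qed.

Lemma seq_argmax (R : realType) (T : eqType) (f : T -> R) (s : seq T) :
  s != [::] -> exists2 c, c \in s & forall b, b \in s -> f b <= f c.
Proof.
elim: s => [//|a s IH _]; have [->|/IH [c cs cm]] := eqVneq s [::].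
  by exists a; rewrite ?mem_head// => b /[!inE] /eqP ->.
have [h|h] := leP (f a) (f c).
  exists c => [|b]; first by rewrite in_cons cs orbT.
  by rewrite in_cons => /orP[/eqP ->|/cm].
exists a => [|b]; first by rewrite mem_head.
by rewrite in_cons => /orP[/eqP ->//|/cm bc]; lra.
Qed.

(* Starting from a direction x0 inside the region of u, turn towards the side
   prescribed by s until the region is left. *)
Lemma vertex_surj (R : realType) (B : seq 'rV[R]_2) (s : R)
    (x0 u : 'rV[R]_2) : s != 0 -> u \in B ->
  (forall b, b \in B -> b != u -> dot b x0 < dot u x0) ->
  (exists2 b, b \in B & b != u) ->
  exists r, [/\ r != 0, vertex B s r = u & vertex B (- s) r != u].
Proof.
move=> s0 uB um [b0 b0B b0u].
have x00 : x0 != 0.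
  by apply/eqP => x00; have := um _ b0B b0u; rewrite x00 !(dotC _ 0) !dot0l ltxx.
(* In the direction [p *: x0 - rot s x0], [b] is below [u] exactly when [p > q b]. As [p] decreases,
   the first tie with [u] therefore occurs at the largest [q b]. *)
pose q b := dot (b - u) (rot s x0) / dot (b - u) x0.
have [|c] := seq_argmax q (s := [seq b <- B | b != u]).
  by apply/eqP => e; have := mem_filter (fun b => b != u) b0 B; rewrite e b0u b0B.
rewrite mem_filter => /andP[cu cB] cm.
have {}um b : b \in B -> b != u -> dot (b - u) x0 < 0.
  by move=> bB bu; rewrite dotBl subr_lt0 um.
pose r := q c *: x0 - rot s x0.
have rE b : dot (b - u) r = q c * dot (b - u) x0 - dot (b - u) (rot s x0).
  by rewrite dotBr dotZr.
have rle b : b \in B -> b != u -> dot (b - u) r <= 0.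
  move=> bB bu; have := cm b; rewrite mem_filter bu bB => /(_ isT).
  by rewrite rE subr_le0 /q ler_ndivrMr ?um.
have rc : dot (c - u) r = 0.
  by rewrite rE /q divfK ?subrr// lt_eqF ?um.
have rrE b : dot (b - u) (rot s r) =
    q c * dot (b - u) (rot s x0) + s ^+ 2 * dot (b - u) x0.
  rewrite !dot2E !rotE0 !rotE1 !mxE /=; ring.
(* At a tie this product is [(q c * q c + s ^+ 2) * dot (b - u) x0], hence negative: [u] wins on the
   side of [s] and loses to [c] on the other. *)
have rr b : b \in B -> b != u -> dot (b - u) r = 0 -> dot (b - u) (rot s r) < 0.
  move=> bB bu /eqP; rewrite rE subr_eq0 => /eqP h.
  rewrite rrE -h mulrA -mulrDl nmulr_llt0 ?um//.
  by rewrite ltr_wpDl ?exprn_even_gt0// -expr2 sqr_ge0.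
have r0 : r != 0.
  apply/eqP => r0; have := rr c cB cu rc.
  by rewrite r0 -(scale0r 0) rotZ dotZr mul0r ltxx.
have B0 : B != [::] by case: (B) uB.
exists r; split=> //.
  apply: lexmax_vertex => //; split=> // b bB.
  have [->|bu] := eqVneq b u; first by right.
  have := rle b bB bu; have := rr b bB bu; rewrite !dotBl; lra.
apply/eqP => e; have := vertexP (- s) r B0; rewrite e => -[_ /(_ _ cB)].
by have := rr c cB cu rc; rewrite rotN !dotNr; move: rc; rewrite !dotBl; lra.
Qed.

(** Replaces the infinitesimal tie-breaking by an actual direction [r + e *: rot s r], with [e]
    small enough for the whole finite set [B]. *)
Lemma vertex_strict (R : realType) (B : seq 'rV[R]_2) (s : R)
    (r : 'rV[R]_2) : B != [::] -> s != 0 -> r != 0 ->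
  exists x, forall b, b \in B -> b != vertex B s r ->
    dot b x < dot (vertex B s r) x.
Proof.
move=> B0 s0 r0; have [_] := vertexP s r B0; move: (vertex B s r) => u um.
have [e e0 he] : exists2 e, 0 < e & forall t, 0 < t <= e ->
    forall b, b \in B -> b != u ->
    dot b (r + t *: rot s r) < dot u (r + t *: rot s r).
  elim: B {B0} um => [|b B IH] um; first by exists 1.
  have [|e e0 he] := IH; first by move=> b' b'B; apply: um; rewrite in_cons b'B orbT.
  have [f f0 hf] : exists2 f, 0 < f & forall t, 0 < t <= f -> b != u ->
      dot b (r + t *: rot s r) < dot u (r + t *: rot s r).
    have [->|bu] := eqVneq b u; first by exists 1.
    have [h|[h1 h2]] := um b (mem_head _ _).
      pose k := 1 + `|dot (b - u) (rot s r)|.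
      have k0 : 0 < k by rewrite ltr_wpDr.
      have hr : 0 < dot (u - b) r by rewrite dotBl subr_gt0.
      (* For [t] up to this bound, what [b] gains on [u] along [rot s r], at most [t * k], is at
         most half of what it loses along [r]. *)
      exists (dot (u - b) r / (2 * k)); first by rewrite divr_gt0// mulr_gt0.
      move=> t /andP[t0]; rewrite ler_pdivlMr ?mulr_gt0// => tk _.
      rewrite -subr_lt0 -dotBl dotDr dotZr.
      have : dot (b - u) (rot s r) <= k.
        by rewrite /k (le_trans (ler_norm _))// lerDr.
      move/(ler_wpM2l (ltW t0)) => h3.
      by move: hr h3 tk; rewrite -(opprB b u) dotNl; lra.
    exists 1 => // t /andP[t0 _] _; rewrite !dotDr !dotZr h1 ltrD2l ltr_pM2l//.
    rewrite lt_neqAle h2 andbT -subr_eq0 -dotBl; apply: contra bu => /eqP h3.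
    rewrite -subr_eq0; apply/eqP/(frame_eq0 s0 r0) => //.
    by rewrite dotBl h1 subrr.
  exists (Num.min e f) => [|t]; first by rewrite lt_min e0.
  rewrite le_min => /andP[t0 /andP[te tf]] c.
  rewrite in_cons => /orP[/eqP -> cu|cB cu]; first by apply: hf; rewrite ?t0.
  by apply: he; rewrite ?t0.
by exists (r + e *: rot s r); apply: he; rewrite e0 lexx.
Qed.

(** * Boundary rays of the regions and their balancing *)

Definition distinct_rays (R : realType) (L : seq 'rV[R]_2) : Prop :=
  [/\ uniq L, 0 \notin L & {in L &, forall v w, same_ray v w -> v = w}].

(** Only one inclusion is asked for: [L] may also contain rays with zero jump. *)
Definition covers_rays (R : realType) (L B : seq 'rV[R]_2) : Prop :=
  forall r, r != 0 -> 0 < jump B r -> exists2 v, v \in L & same_ray v r.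

Lemma neq0_in (R : realType) (L : seq 'rV[R]_2) v :
  0 \notin L -> v \in L -> v != 0.
Proof. by move=> L0 vL; apply: contraNneq L0 => <-. Qed.

Lemma jump_gt0 (R : realType) (B : seq 'rV[R]_2) (r : 'rV[R]_2) :
  B != [::] -> r != 0 ->
  (0 < jump B r) = (vertex B 1 r != vertex B (-1) r).
Proof.
move=> B0 r0; rewrite lt_neqAle jump_ge0// andbT eq_sym; congr (~~ _).
by apply/eqP/eqP => /(jump_eq0 B0 r0).
Qed.

(** A positive jump separates the vertices on the two sides of a ray, so [vertex_inj] applies. This
    bounds the number of rays by the number of vertices. *)
Lemma uniq_vertices (R : realType) (B L : seq 'rV[R]_2) (s : R) :
  B != [::] -> s = 1 \/ s = -1 -> distinct_rays L ->
  (forall r, r \in L -> 0 < jump B r) -> uniq (map (vertex B s) L).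
Proof.
move=> B0 s1 [uL L0 Li] Lj; rewrite map_inj_in_uniq// => v w vL wL e.
have v0 := neq0_in L0 vL; have w0 := neq0_in L0 wL.
have s0 : s != 0 by case: s1 => ->; rewrite ?oppr_eq0 oner_eq0.
apply: Li => //; apply: (vertex_inj B0 s0) => //.
  have := Lj _ vL; rewrite jump_gt0//; case: s1 => -> //.
  by rewrite opprK eq_sym.
have := Lj _ wL; rewrite jump_gt0//; case: s1 => -> //.
by rewrite opprK eq_sym.
Qed.

(** Turning away from [x] one meets a boundary ray of the region of [u]. Its jump is positive, so
    [L] contains a generator of it, and the vertex depends only on the ray. *)
Lemma vertices_covered (R : realType) (B L : seq 'rV[R]_2) (s : R)
    (x u : 'rV[R]_2) :
  B != [::] -> s = 1 \/ s = -1 -> 0 \notin L -> covers_rays L B ->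
  u \in B -> (forall b, b \in B -> b != u -> dot b x < dot u x) ->
  (exists2 b, b \in B & b != u) ->
  exists v, [/\ v \in L, 0 < jump B v & vertex B s v = u].
Proof.
move=> B0 s1 L0 cov uB um ex.
have s0 : s != 0 by case: s1 => ->; rewrite ?oppr_eq0 oner_eq0.
have [r [r0 ru rn]] := vertex_surj s0 uB um ex.
have rj : 0 < jump B r.
  rewrite jump_gt0//; move: rn; rewrite -ru; case: s1 => ->; rewrite ?opprK//.
  by rewrite eq_sym.
have [v vL vr] := cov r r0 rj; have v0 := neq0_in L0 vL.
exists v; split=> //; first by case: vr rj => c c0 ->; rewrite jumpZ// pmulr_rgt0.
by case: vr ru => c c0 ->; rewrite vertexZ.
Qed.

(* Each region has exactly one boundary ray on each side, so both sums below
   run over all vertices. *)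
Lemma balancing (R : realType) (B L : seq 'rV[R]_2) :
  B != [::] -> distinct_rays L -> covers_rays L B ->
  \sum_(r <- L) (vertex B 1 r - vertex B (-1) r) = 0.
Proof.
move=> B0 [uL L0 Li] cov.
pose L' := [seq r <- L | 0 < jump B r].
have L'L r : r \in L' -> r \in L by rewrite mem_filter => /andP[].
have L'0 : 0 \notin L' by apply: contra L0 => /L'L.
have L'j r : r \in L' -> 0 < jump B r by rewrite mem_filter => /andP[].
have dL' : distinct_rays L'.
  by split; [exact: filter_uniq|by []|move=> v w /L'L vL /L'L; exact: Li].
have -> : \sum_(r <- L) (vertex B 1 r - vertex B (-1) r) =
          \sum_(r <- L') (vertex B 1 r - vertex B (-1) r).
  rewrite big_filter [RHS]big_mkcond; apply: eq_big_seq => r rL.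
  have r0 := neq0_in L0 rL.
  by rewrite jump_gt0//; case: eqVneq => //= ->; rewrite subrr.
have u1 := uniq_vertices B0 (or_introl erefl) dL' L'j.
have u2 := uniq_vertices B0 (or_intror erefl) dL' L'j.
have sub : {subset map (vertex B 1) L' <= map (vertex B (-1)) L'}.
  move=> _ /mapP[r rL ->]; have r0 := neq0_in L'0 rL.
  have [x hx] := vertex_strict B0 (oner_neq0 R) r0.
  have [|v [vL vj <-]] := vertices_covered B0 (or_intror erefl) L0 cov
    (vertexP 1 r B0).1 hx.
    exists (vertex B (-1) r); first by case: (vertexP (-1) r B0).
    by rewrite eq_sym -jump_gt0// L'j.
  by apply: map_f; rewrite mem_filter vj.
(* Both lists have the size of [L'], so the inclusion makes one a permutation of the other. *)
have [|_ me] := uniq_min_size u1 sub; first by rewrite !size_map.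
have e s : \sum_(r <- L') vertex B s r = \sum_(u <- map (vertex B s) L') u.
  by rewrite big_map.
by rewrite big_split /= sumrN !e (perm_big _ (uniq_perm u1 u2 me)) subrr.
Qed.

Lemma rotD (R : realType) (s : R) (u v : 'rV[R]_2) :
  rot s (u + v) = rot s u + rot s v.
Proof. by apply/rowP => i; rewrite !mxE; case: ifP => _; ring. Qed.

(** The jump of the gradient is orthogonal to its ray, so this is [balancing] rotated by a right
    angle. Each summand is the generator of its ray whose norm is the weight. *)
Lemma jump_balancing (R : realType) (B L : seq 'rV[R]_2) :
  B != [::] -> distinct_rays L -> covers_rays L B ->
  \sum_(r <- L) (jump B r / dot r r) *: r = 0.
Proof.
move=> B0 dL cov; have := balancing B0 dL cov.
have -> : \sum_(r <- L) (vertex B 1 r - vertex B (-1) r) =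
          \sum_(r <- L) rot 1 ((jump B r / dot r r) *: r).
  apply: eq_big_seq => r rL; have [_ L0 _] := dL.
  have rr := dot_gt0 (neq0_in L0 rL).
  apply: (scalerI (lt0r_neq0 rr)); rewrite jumpE// rotZ scalerA.
  by rewrite mulrC divfK ?lt0r_neq0.
have rot0 : rot 1 0 = 0 :> 'rV[R]_2.
  by apply/rowP => i; rewrite !mxE !mulr0; case: ifP.
rewrite -(big_morph (rot 1) (rotD 1) rot0) => h.
have /eqP := congr1 (rot 1) h.
by rewrite rot_rot expr1n scale1r rot0 oppr_eq0 => /eqP.
Qed.

(** * Tropical polynomials, their gradients and germs *)

Lemma tropicalP (R : realType) d (g : 'rV[R]_d -> R) :
  tropical_polynomial g ->
  exists (n : nat) (a : 'I_n.+1 -> R) (b : 'I_n.+1 -> 'rV[R]_d),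
    (forall x i, dot (b i) x + a i <= g x) /\
    forall x, exists i, g x = dot (b i) x + a i.
Proof.
move=> [n [a [b gE]]]; exists n, a, b; split=> x.
  by move=> i; rewrite gE; exact: (le_bigmax _ (fun i => dot (b i) x + a i) i).
rewrite gE.
elim/big_ind: _ => [|_ _ [i ->] [j ->]|i _]; [by exists ord0| |by exists i].
by rewrite /Num.max; case: ifP; [exists j|exists i].
Qed.

Lemma dot_continuous (R : realType) d (u : 'rV[R]_d) : continuous (dot u).
Proof.
apply: continuous_big => [|i _]; first exact: add_continuous.
have h : continuous (fun x : 'rV[R]_d => x 0 i) by exact: coord_continuous.
by move=> x; apply: (continuous_comp (h x)); exact: mulrl_continuous.
Qed.

Lemma near_affine_gt0 (R : realType) d (u x : 'rV[R]_d) (c : R) :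
  0 < dot u x + c -> \forall y \near x, 0 < dot u y + c.
Proof.
have ctn : continuous (fun y => dot u y + c).
  by move=> y; apply: continuousD; [exact: dot_continuous|exact: cst_continuous].
by move=> h; exact: (cvgr_gt _ (ctn x)).
Qed.

Lemma all_near (R : realType) d (x : 'rV[R]_d) (P : set 'rV[R]_d) :
  (forall y, P y) -> \forall y \near x, P y.
Proof. by move=> h; apply: (@filterS _ (nbhs x) _ setT) => //; exact: filterT. Qed.

Lemma near_all (T : Type) (U : eqType) (F : set_system T) {FF : Filter F}
    (s : seq U) (P : U -> T -> Prop) :
  (forall b, b \in s -> \forall t \near F, P b t) ->
  \forall t \near F, forall b, b \in s -> P b t.
Proof.
elim: s => [_|a s IH h]; first exact: nearW.
have h1 := h a (mem_head _ _).
have h2 : \forall t \near F, forall b, b \in s -> P b t.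
  by apply: IH => b bs; apply: h; rewrite in_cons bs orbT.
apply: filterS2 h1 h2 => t h1 h2 b.
by rewrite in_cons => /orP[/eqP ->|/h2].
Qed.

(** Transfers a property of the germ at [x] to full neighbourhoods of the points of a ray close to
    [x]. *)
Lemma near_ray (R : realType) d (P : set 'rV[R]_d) (x v : 'rV[R]_d) :
  (\forall y \near x, P y) ->
  \forall t \near 0^'+, \forall y \near x + t *: v, P y.
Proof.
move=> /near_join; apply: cvg_at_right_filter.
rewrite -[X in _ --> X](addr0 x) -(scale0r v).
apply: cvgD; [exact: cvg_cst|apply: cvgZr_tmp]; exact: cvg_id.
Qed.

Lemma right_witness (R : realType) (P : R -> Prop) :
  (\forall t \near 0^'+, P t) -> exists2 t, 0 < t & P t.
Proof.
move=> h.
have h' : \forall t \near 0^'+, P t /\ 0 < t.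
  by apply: filterI => //; exact: nbhs_right_gt.
by have [t [Pt t0]] := @filter_ex _ _ (at_right_proper_filter 0) _ h'; exists t.
Qed.

(** Evaluation at [x] gives [c = 0]; then [w] vanishes on a half-space, and on the opposite one by
    linearity. For [q = 0] the condition on [y] is void. *)
Lemma half_space_eq0 (R : realType) d (w q x : 'rV[R]_d) (c : R) :
  (\forall y \near x, 0 <= dot (y - x) q -> dot w (y - x) = c) -> w = 0.
Proof.
move=> h.
have c0 : c = 0.
  have := nbhs_singleton h; rewrite /= subrr dot0l => /(_ (lexx _)) <-.
  by rewrite dotC dot0l.
have hz z : 0 <= dot z q -> dot w z = 0.
  move=> zq; have [t t0 ht] := right_witness (near_ray z h).
  have := nbhs_singleton ht; rewrite /= addrC addKr !(dotZl, dotZr) c0.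
  rewrite mulr_ge0 ?(ltW t0)// => /(_ isT)/eqP.
  by rewrite mulf_eq0 gt_eqF//= => /eqP.
apply: dot_separating => z; have [/hz//|zq] := leP 0 (dot z q).
by apply/eqP; rewrite -oppr_eq0 -dotNr hz// dotNl oppr_ge0 ltW.
Qed.

(* B consists of the exponents of g that are active at tau, i.e. it spans the
   Newton polytope of the germ of g at tau. *)
Definition tangent_exponents (R : realType) d (g : 'rV[R]_d -> R)
    (tau : 'rV[R]_d) (B : seq 'rV[R]_d) : Prop :=
  B != [::] /\
  \forall y \near tau,
    (forall b, b \in B -> g tau + dot b (y - tau) <= g y) /\
    exists2 b, b \in B & g y = g tau + dot b (y - tau).

Lemma tangent_exists (R : realType) d (g : 'rV[R]_d -> R) (tau : 'rV[R]_d) :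
  tropical_polynomial g -> exists B, tangent_exponents g tau B.
Proof.
move=> /tropicalP [n [a [b [gle gex]]]].
pose B := [seq b i | i <- enum 'I_n.+1 & dot (b i) tau + a i == g tau].
have actE i y : dot (b i) tau + a i = g tau ->
    dot (b i) y + a i = g tau + dot (b i) (y - tau).
  by move=> <-; rewrite dotBr; lra.
have [i0 hi0] := gex tau.
have memB i : dot (b i) tau + a i = g tau -> b i \in B.
  by move=> hi; apply: map_f; rewrite mem_filter hi eqxx mem_enum.
exists B; split; first by case: (B) (memB i0 (esym hi0)).
(* By continuity, the finitely many terms inactive at [tau] stay strictly below [g] nearby. *)
have /filter_forall : forall i, \forall y \near tau,
    dot (b i) tau + a i != g tau -> dot (b i) y + a i < g y.
  move=> i.
  have [e|ne] := eqVneq (dot (b i) tau + a i) (g tau).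
    exact: all_near.
  have h : 0 < dot (b i0 - b i) tau + (a i0 - a i).
    have : dot (b i) tau + a i < g tau by rewrite lt_neqAle ne gle.
    by rewrite hi0 dotBl; lra.
  apply: filterS (near_affine_gt0 h) => y /= hy _.
  by have := gle y i0; move: hy; rewrite dotBl; lra.
apply: filterS => y hy; split.
  move=> _ /mapP[i + ->]; rewrite mem_filter => /andP[/eqP hi _].
  by rewrite -actE.
have [i gi] := gex y; have [hi|/hy] := eqVneq (dot (b i) tau + a i) (g tau).
  by exists (b i); [exact: memB|rewrite gi actE].
by rewrite gi ltxx.
Qed.

(** Exponents strictly below the vertex along [v] stay below it near [tau + t *: v]; those tied
    along [v] are compared by the sign of the coordinate along [rot s v]. *)
Lemma sector (R : realType) (g : 'rV[R]_2 -> R) (tau : 'rV[R]_2)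
    (B : seq 'rV[R]_2) (s : R) (v : 'rV[R]_2) :
  tangent_exponents g tau B -> s != 0 -> v != 0 ->
  \forall t \near 0^'+, \forall y \near tau + t *: v,
    0 <= dot (y - tau) (rot s v) ->
    g y = g tau + dot (vertex B s v) (y - tau).
Proof.
move=> [B0 Bg] s0 v0; set u := vertex B s v.
have [uB um] := vertexP s v B0; rewrite -/u in uB um.
have hB : \forall t \near 0^'+, forall b, b \in B ->
    \forall y \near tau + t *: v, 0 <= dot (y - tau) (rot s v) ->
      dot b (y - tau) <= dot u (y - tau).
  apply: near_all => b bB; have [h|[h1 h2]] := um b bB; last first.
    apply: nearW => t; apply: all_near => y hy.
    rewrite -subr_le0 -dotBl -(pmulr_rle0 _ (frame_gt0 s0 v0)) frameE.
    rewrite dotBl h1 subrr mul0r mulr0 add0r mulr_le0_ge0//.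
    by rewrite dotBl subr_le0.
  apply: filterS (nbhs_right_gt (0 : R)) => t t0.
  have h' : 0 < dot (u - b) (tau + t *: v) + dot (b - u) tau.
    rewrite -(opprB u b) dotNl dotDr dotZr addrC addKr mulr_gt0//.
    by rewrite dotBl subr_gt0.
  apply: filterS (near_affine_gt0 h') => y /= hy _.
  by move: hy; rewrite !(dotBr, dotBl); lra.
apply: filterS2 (near_ray v Bg) hB => t h1 h2.
apply: filterS2 h1 (near_all h2) => y [yge [b bB gy]] hy yq.
by apply/eqP; rewrite eq_le yge// andbT gy lerD2l hy.
Qed.

(** * Linear regions and their gradients *)

Definition gradient_at (R : realType) d (g : 'rV[R]_d -> R)
    (x u : 'rV[R]_d) : Prop :=
  exists c, \forall y \near x, g y = dot u y + c.

Definition gradients (R : realType) d (g : 'rV[R]_d -> R) : set 'rV[R]_d :=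
  [set u | exists x, gradient_at g x u].

Lemma gradient_at_unique (R : realType) d (g : 'rV[R]_d -> R)
    (x u v : 'rV[R]_d) : gradient_at g x u -> gradient_at g x v -> u = v.
Proof.
move=> [c hc] [e he]; apply/eqP; rewrite -subr_eq0; apply/eqP.
apply: (@half_space_eq0 _ _ _ 0 x (e - c - dot (u - v) x)).
by apply: filterS2 hc he => y -> hy _; rewrite !(dotBl, dotBr); lra.
Qed.

Lemma gradient_at_near (R : realType) d (g : 'rV[R]_d -> R)
    (x u : 'rV[R]_d) :
  gradient_at g x u -> \forall y \near x, gradient_at g y u.
Proof.
by move=> [c /near_join hc]; apply: filterS hc => y hy; exists c.
Qed.

(** Off the nonlinear locus, having gradient [u] is both an open and a closed condition. *)
Lemma gradient_constant (R : realType) d (g : 'rV[R]_d -> R)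
    (A : set 'rV[R]_d) (x y u : 'rV[R]_d) :
  connected A -> A `<=` ~` nonlinear_locus g -> A x -> A y ->
  gradient_at g x u -> gradient_at g y u.
Proof.
move=> cA Alin Ax Ay gx.
have eqA : A `&` [set z | gradient_at g z u] = A.
  apply: cA; first by exists x.
    exists [set z | gradient_at g z u] => //.
    by rewrite openE => z; exact: gradient_at_near.
  exists (~` [set z | exists2 v, v != u & gradient_at g z v]).
    apply: open_closedC; rewrite openE => z [v vu /gradient_at_near].
    by apply: filterS => t; exists v.
  apply/seteqP; split=> z [Az h]; split=> //.
    by move=> [v vu gv]; move/eqP: vu; apply; exact: gradient_at_unique gv h.
  have /contrapT [v gv] := Alin _ Az.
  have [<-//|vu] := eqVneq v u; case: h; exists v => //.
by move: Ay; rewrite -eqA => -[].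
Qed.

(** Test the inequality at [y = x - t *: w]. *)
Lemma near_ge0_eq0 (R : realType) d (w x : 'rV[R]_d) :
  (\forall y \near x, 0 <= dot w (y - x)) -> w = 0.
Proof.
move=> /(near_ray (- w))/right_witness [t t0 /nbhs_singleton /=].
rewrite addrC addKr dotZr dotNr pmulr_rge0// oppr_ge0 => h.
by apply/eqP; apply: contraTT h => /dot_gt0; rewrite ltNge.
Qed.

(** At a point with gradient [u] a single affine term is active. Terms strictly below it at both
    ends stay strictly below it in between. *)
Lemma segment_in_region (R : realType) d (g : 'rV[R]_d -> R)
    (x y u : 'rV[R]_d) (t : R) : tropical_polynomial g ->
  gradient_at g x u -> gradient_at g y u -> 0 <= t <= 1 ->
  gradient_at g ((1 - t) *: x + t *: y) u.
Proof.
move=> /tropicalP [n [a [b [gle gex]]]].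
have term z : gradient_at g z u -> exists c,
    [/\ exists i, b i = u /\ a i = c
      & forall i, dot (b i) z + a i < dot u z + c \/ b i = u /\ a i = c].
  move=> [c hc]; exists c; have hz := nbhs_singleton hc; rewrite /= in hz.
  have hi i : dot (b i) z + a i = dot u z + c -> b i = u /\ a i = c.
    move=> e; suff ub : u = b i by split=> //; move: e; rewrite ub; lra.
    apply/eqP; rewrite -subr_eq0; apply/eqP/(@near_ge0_eq0 _ _ _ z).
    apply: filterS hc => w hw; have := gle w i; move: e.
    by rewrite hw dotBr !dotBl; lra.
  split; first by have [i e] := gex z; exists i; apply: hi; rewrite -e.
  move=> i; have := gle z i; rewrite hz le_eqVlt => /orP[/eqP/hi|]; first by right.
  by left.
move=> /term [c [[i [bi ai]] hx]] /term [e [[j [bj aj]] hy]] /andP[t0 t1].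
(* Both ends see the same affine term, as each constant is at most the other. *)
have {j bj aj} ce : e = c.
  have := hx j; have := hy i; rewrite bi ai bj aj; lra.
rewrite {e}ce in hy; exists c; set z := _ + _.
have /filter_forall : forall k, \forall w \near z,
    dot (b k) w + a k <= dot u w + c.
  move=> k.
  have [[-> ->]|nk] := pselect (b k = u /\ a k = c); first exact: all_near.
  have {}hx : dot (b k) x + a k < dot u x + c by have := hx k; tauto.
  have {}hy : dot (b k) y + a k < dot u y + c by have := hy k; tauto.
  have h : 0 < dot (u - b k) z + (c - a k).
    have [t0'|t0'] := eqVneq t 0.
      by rewrite /z t0' subr0 scale1r scale0r addr0 dotBl; lra.
    rewrite /z dotDr !dotZr !dotBl.
    have tp : 0 < t by rewrite lt0r t0'.
    have h1 : 0 <= (1 - t) * (dot u x + c - dot (b k) x - a k).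
      by apply: mulr_ge0; lra.
    have h2 : 0 < t * (dot u y + c - dot (b k) y - a k) by apply: mulr_gt0; lra.
    by lra.
  by apply: filterS (near_affine_gt0 h) => w; rewrite /= dotBl; lra.
apply: filterS => w hw; have [k gk] := gex w.
apply/eqP; rewrite eq_le {1}gk hw /=.
by rewrite -bi -ai gle.
Qed.

(** Sending a region to its gradient is a bijection: the gradient is constant on a component, and
    points with equal gradients are joined by a segment inside the linear locus. *)
Lemma linear_regions_gradients (R : realType) d (g : 'rV[R]_d -> R) :
  tropical_polynomial g ->
  finite_set (gradients g) /\ (linear_regions g #= gradients g)%card.
Proof.
move=> tg; split.
  have [n [a [b [gle gex]]]] := tropicalP tg.
  (* Every gradient is the exponent of a term active at the point. *)
  apply: (@sub_finite_set _ _ (range b)); last exact: finite_image.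
  move=> u [x [c hc]]; have [i e] := gex x; exists i => //.
  apply/esym/eqP; rewrite -subr_eq0; apply/eqP/(@near_ge0_eq0 _ _ _ x).
  have hx := nbhs_singleton hc; rewrite /= in hx.
  apply: filterS hc => w hw; have := gle w i; move: e.
  by rewrite hw hx dotBr !dotBl; lra.
pose pt u : 'rV[R]_d := xget 0 [set x | gradient_at g x u].
pose C := connected_component (~` nonlinear_locus g).
have ptP u : gradients g u -> gradient_at g (pt u) u.
  exact: (@xgetPex _ 0 [set x | gradient_at g x u]).
have lin x u : gradient_at g x u -> (~` nonlinear_locus g) x.
  by move=> [c hc]; apply; exists u, c.
have CE x u : gradient_at g x u -> C (pt u) = C x.
  move=> gx; apply: same_connected_component.
  have gp : gradient_at g (pt u) u by apply: ptP; exists x.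
  pose f (t : R) := (1 - t) *: pt u + t *: x.
  have cf : connected (f @` `[0, 1]).
    apply: connected_continuous_connected; first exact: segment_connected.
    apply: continuous_subspaceT => t.
    apply: cvgD; apply: cvgZr_tmp; last exact: cvg_id.
    by apply: cvgB; [exact: cvg_cst|exact: cvg_id].
  apply: (@connected_component_max _ _ (f @` `[0, 1])) => //.
  - exists 0; first by rewrite /= in_itv /= lexx ler01.
    by rewrite /f subr0 scale1r scale0r addr0.
  - move=> _ [t /= + <-]; rewrite in_itv /= => t01.
    by apply: lin; apply: segment_in_region gp gx t01.
  - exists 1; first by rewrite /= in_itv /= lexx ler01.
    by rewrite /f subrr scale1r scale0r add0r.
have -> : linear_regions g = [set C (pt u) | u in gradients g].
  apply/seteqP; split=> [_ [x /= xl <-]|_ [u gu <-]].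
    have /contrapT [u [c hc]] := xl.
    have gx : gradient_at g x u by exists c.
    by exists u; [exists x|rewrite (CE x)].
  by exists (pt u) => //; apply: lin; exact: ptP.
apply: inj_card_eq => u v; rewrite !inE => gu gv e.
apply: (@gradient_at_unique _ _ g (pt v)); last exact: ptP.
have uC : C (pt u) (pt u) by apply: connected_component_refl; apply: lin; exact: ptP.
apply: (@gradient_constant _ _ g (C (pt u)) (pt u)) => //.
- exact: component_connected.
- exact: connected_component_sub.
- by rewrite e; apply: connected_component_refl; apply: lin; exact: ptP.
- exact: ptP.
Qed.

Lemma mComp_gradients (R : realType) d (g : 'rV[R]_d -> R) :
  tropical_polynomial g ->
  mComp g = #|` fset_set (gradients g)|.
Proof.
move=> /linear_regions_gradients [fg cg]; apply/fcard_eq => //.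
by rewrite (eq_finite_set cg).
Qed.

Lemma mComp_le (R : realType) d (g : 'rV[R]_d -> R) (L : seq 'rV[R]_d) :
  tropical_polynomial g -> gradients g `<=` [set` L] -> (mComp g <= size L)%N.
Proof.
move=> tg gL; rewrite mComp_gradients//.
have [fg _] := linear_regions_gradients tg.
apply: uniq_leq_size => [|u]; first exact: fset_uniq.
by rewrite in_fset_set// inE => /gL.
Qed.

Lemma mComp_ge (R : realType) d (g : 'rV[R]_d -> R) (L : seq 'rV[R]_d) :
  tropical_polynomial g -> uniq L -> [set` L] `<=` gradients g ->
  (size L <= mComp g)%N.
Proof.
move=> tg uL Lg; rewrite mComp_gradients//.
have [fg _] := linear_regions_gradients tg.
apply: uniq_leq_size => // u uL'.
by rewrite in_fset_set// inE; exact: Lg.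
Qed.

Lemma vertex_gradient (R : realType) (g : 'rV[R]_2 -> R) (tau : 'rV[R]_2)
    (B : seq 'rV[R]_2) (s : R) (v : 'rV[R]_2) :
  tangent_exponents g tau B -> s != 0 -> v != 0 ->
  gradients g (vertex B s v).
Proof.
move=> Bg s0 v0; have [t t0 ht] := right_witness (sector Bg s0 v0).
have [e e0 he] := right_witness (near_ray (rot s v) ht).
(* A point pushed off the ray to the side of [s], around which the sector formula holds on a whole
   neighbourhood. *)
exists (tau + t *: v + e *: rot s v).
exists (g tau - dot (vertex B s v) tau).
have h : 0 < dot (rot s v) (tau + t *: v + e *: rot s v)
           + - dot (rot s v) tau.
  rewrite !dotDr !dotZr (dotC _ v) dot_rot mulr0 addr0 addrC addKr.
  rewrite mulr_gt0//.
  have -> : dot (rot s v) (rot s v) = s ^+ 2 * dot v v.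
    by rewrite !dot2E !rotE0 !rotE1; ring.
  exact: frame_gt0.
apply: filterS2 he (near_affine_gt0 h) => y /= hy hq.
have -> : g y = g tau + dot (vertex B s v) (y - tau).
  by apply: hy; rewrite dotC dotBr ltW.
by rewrite dotBr; lra.
Qed.

(** A conic locus lets [x] be contracted towards [tau] inside its region, down to where [B]
    describes [g]. There [u] is the only active exponent. *)
Lemma gradient_strict (R : realType) (g : 'rV[R]_2 -> R) (tau : 'rV[R]_2)
    (B : seq 'rV[R]_2) (u : 'rV[R]_2) :
  tangent_exponents g tau B ->
  (forall x t, 0 < t -> nonlinear_locus g (tau + t *: (x - tau)) ->
     nonlinear_locus g x) ->
  gradients g u ->
  u \in B /\ exists z, forall b, b \in B -> b != u -> dot b z < dot u z.
Proof.
move=> [B0 Bg] conic [x gx].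
have {Bg} : \forall t \near 0^'+, t <= 1 /\
    \forall y \near tau + t *: (x - tau),
    (forall b, b \in B -> g tau + dot b (y - tau) <= g y) /\
    exists2 b, b \in B & g y = g tau + dot b (y - tau).
  by apply: filterI; [exact: nbhs_right_le|exact: near_ray].
move=> /right_witness [t t0 [t1 Bx]].
set z := t *: (x - tau) in Bx.
have [c hc] : gradient_at g (tau + z) u.
  pose f (r : R) := tau + r *: (x - tau).
  have cf : connected (f @` `[t, 1]).
    apply: connected_continuous_connected; first exact: segment_connected.
    apply: continuous_subspaceT => r.
    by apply: cvgD; [exact: cvg_cst|apply: cvgZr_tmp; exact: cvg_id].
  apply: (gradient_constant cf _ _ _ gx).
  - move=> _ [r /= + <-]; rewrite in_itv /= => /andP[tr _] /conic.
    by apply; [exact: lt_le_trans tr|case: gx => c hc; exists u, c].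
  - exists 1; first by rewrite /= in_itv /= t1 lexx.
    by rewrite /f scale1r addrC subrK.
  - by exists t; first by rewrite /= in_itv /= t1 lexx.
have zE : tau + z - tau = z by rewrite addrC addKr.
have [_ [b bB e]] := nbhs_singleton Bx; rewrite zE in e.
(* Near [tau + z], [g] lies above the affine term of [a] and touches it at that point, so the
   gradients agree. *)
have act a : a \in B -> g (tau + z) = g tau + dot a z -> a = u.
  move=> aB ea; apply/esym/eqP; rewrite -subr_eq0; apply/eqP.
  apply: (@near_ge0_eq0 _ _ _ (tau + z)).
  have hz := nbhs_singleton hc; rewrite /= in hz.
  apply: filterS2 Bx hc => y [/(_ a aB) + _] hy; rewrite hy.
  move: ea; rewrite hz => ea.
  by rewrite !(dotBr, dotBl, dotDr) in ea *; lra.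
have ub : b = u by exact: act.
rewrite ub in bB e; split=> //; exists z => a aB au.
have [/(_ a aB) + _] := nbhs_singleton Bx; rewrite /= e lerD2l zE.
rewrite le_eqVlt => /orP[/eqP ea|//]; move/eqP: au; case.
by apply: act => //; rewrite e ea.
Qed.

(** * Counting regions by rays *)

Lemma mComp_ge_rays (R : realType) (g : 'rV[R]_2 -> R) (tau : 'rV[R]_2)
    (B L : seq 'rV[R]_2) :
  tropical_polynomial g -> tangent_exponents g tau B ->
  distinct_rays L -> (forall r, r \in L -> 0 < jump B r) ->
  (size L <= mComp g)%N.
Proof.
move=> tg Bg dL Lj; have [B0 _] := Bg; have [_ L0 _] := dL.
rewrite -(size_map (vertex B 1)); apply: mComp_ge => //.
  exact: uniq_vertices (or_introl erefl) dL Lj.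
move=> _ /mapP[v vL ->]; apply: vertex_gradient Bg (oner_neq0 R) _.
exact: neq0_in vL.
Qed.

Lemma mComp_gt0 (R : realType) (g : 'rV[R]_2 -> R) :
  tropical_polynomial g -> (0 < mComp g)%N.
Proof.
move=> tg; have [B Bg] := tangent_exists 0 tg.
have v0 : const_mx 1 != 0 :> 'rV[R]_2.
  by apply/eqP => /rowP/(_ 0) /eqP; rewrite !mxE oner_eq0.
apply: (@mComp_ge _ _ _ [:: vertex B 1 (const_mx 1)]) => // u /=.
by rewrite inE => /eqP ->; exact: vertex_gradient Bg (oner_neq0 R) v0.
Qed.

(** Every gradient is a vertex next to a ray of [L], unless [B] contains no exponent besides some
    gradient. In that case there is a single region, whence the maximum with 1. *)
Lemma mComp_le_rays (R : realType) (g : 'rV[R]_2 -> R) (tau : 'rV[R]_2)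
    (B L : seq 'rV[R]_2) :
  tropical_polynomial g -> tangent_exponents g tau B ->
  (forall x t, 0 < t -> nonlinear_locus g (tau + t *: (x - tau)) ->
     nonlinear_locus g x) ->
  0 \notin L -> covers_rays L B -> (mComp g <= maxn 1 (size L))%N.
Proof.
move=> tg Bg conic L0 cov; have [B0 _] := Bg.
have [all_ex|/existsNP[u /not_implyP[gu nex]]] :=
    pselect (forall u, gradients g u -> exists2 b, b \in B & b != u).
  apply: leq_trans (leq_maxr _ _).
  rewrite -(size_map (vertex B 1)); apply: mComp_le => // u gu.
  have [uB [z uz]] := gradient_strict Bg conic gu.
  have [v [vL _ <-]] := vertices_covered B0 (or_introl erefl) L0 cov uB uz
    (all_ex u gu).
  exact: map_f.
apply: leq_trans (leq_maxl _ _); apply: (@mComp_le _ _ _ [:: u]) => // w gw.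
have [wB _] := gradient_strict Bg conic gw.
rewrite /= inE; apply: contraT => wu; case: nex; by exists w.
Qed.

Lemma right_witness2 (R : realType) (P Q : R -> Prop) :
  (\forall t \near 0^'+, P t) -> (\forall t \near 0^'+, Q t) ->
  exists t, [/\ 0 < t, P t & Q t].
Proof.
move=> hP hQ; have [|t t0 [Pt Qt]] := @right_witness R (fun t => P t /\ Q t).
  exact: filterI.
by exists t.
Qed.

(** * Jumps of a difference of tropical polynomials *)

Lemma sector_sub (R : realType) (g h : 'rV[R]_2 -> R) (tau : 'rV[R]_2)
    (Bg Bh : seq 'rV[R]_2) (s : R) (v : 'rV[R]_2) :
  tangent_exponents g tau Bg -> tangent_exponents h tau Bh ->
  s != 0 -> v != 0 ->
  \forall t \near 0^'+, \forall y \near tau + t *: v,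
    0 <= dot (y - tau) (rot s v) ->
    g y - h y = g tau - h tau + dot (vertex Bg s v - vertex Bh s v) (y - tau).
Proof.
move=> tBg tBh s0 v0.
apply: filterS2 (sector tBg s0 v0) (sector tBh s0 v0) => t.
apply: filterS2 => y hg hh hy.
by rewrite (hg hy) (hh hy) dotBl; lra.
Qed.

Lemma dot_rot_shift (R : realType) (s t : R) (y tau r : 'rV[R]_2) :
  dot (y - (tau + t *: r)) (rot s r) = dot (y - tau) (rot s r).
Proof. by rewrite !(dotBl, dotDl, dotZl) dot_rot; lra. Qed.

(** On the side of the ray given by [s], both expressions are the linear part of the same function
    [g - h]. *)
Lemma vertex_sub (R : realType) (g h g' h' : 'rV[R]_2 -> R)
    (tau : 'rV[R]_2) (Bg Bh Bg' Bh' : seq 'rV[R]_2) (s : R) (v : 'rV[R]_2) :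
  tangent_exponents g tau Bg -> tangent_exponents h tau Bh ->
  tangent_exponents g' tau Bg' -> tangent_exponents h' tau Bh' ->
  (forall x, g x - h x = g' x - h' x) -> s != 0 -> v != 0 ->
  vertex Bg s v - vertex Bh s v = vertex Bg' s v - vertex Bh' s v.
Proof.
move=> tBg tBh tBg' tBh' e s0 v0.
have [t [t0 h1 h2]] := right_witness2 (sector_sub tBg tBh s0 v0)
  (sector_sub tBg' tBh' s0 v0).
apply/eqP; rewrite -subr_eq0; apply/eqP.
set w := _ - _.
apply: (@half_space_eq0 _ _ w (rot s v) (tau + t *: v) (- dot w (t *: v))).
apply: filterS2 h1 h2 => y hy hy' yq.
rewrite dot_rot_shift in yq.
have := hy' yq; rewrite -e (hy yq) e => /addrI ew.
by rewrite opprD addrA dotBr [dot w (y - tau)]dotBl ew subrr sub0r.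
Qed.

Lemma jump_sub (R : realType) (g h g' h' : 'rV[R]_2 -> R)
    (tau : 'rV[R]_2) (Bg Bh Bg' Bh' : seq 'rV[R]_2) (v : 'rV[R]_2) :
  tangent_exponents g tau Bg -> tangent_exponents h tau Bh ->
  tangent_exponents g' tau Bg' -> tangent_exponents h' tau Bh' ->
  (forall x, g x - h x = g' x - h' x) -> v != 0 ->
  jump Bg v - jump Bh v = jump Bg' v - jump Bh' v.
Proof.
move=> tBg tBh tBg' tBh' e v0.
have e1 := vertex_sub tBg tBh tBg' tBh' e (oner_neq0 R) v0.
have Nn0 : -1 != 0 :> R by rewrite oppr_eq0 oner_neq0.
have e2 := vertex_sub tBg tBh tBg' tBh' e Nn0 v0.
rewrite /jump -!dotBl; congr (dot _ _).
have swap (a b c d : 'rV[R]_2) : a - b - (c - d) = a - c - (b - d).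
  by rewrite !opprD !opprK addrACA.
by rewrite swap [RHS]swap e1 e2.
Qed.

(** * Faces of a conewise linear function *)

Definition ray_union (R : realType) (tau : 'rV[R]_2) (L : seq 'rV[R]_2) :
    set 'rV[R]_2 :=
  [set x | exists2 v, v \in L & ray tau v x].

Lemma ray_union_conic (R : realType) (tau : 'rV[R]_2) (L : seq 'rV[R]_2) x t :
  0 < t -> ray_union tau L (tau + t *: (x - tau)) -> ray_union tau L x.
Proof.
move=> t0 [v vL [c /= c0 /addrI e]]; exists v => //.
exists (c / t); first by rewrite /= divr_ge0 // ltW.
by rewrite mulrC -scalerA e scalerA mulVf ?gt_eqF// scale1r addrC subrK.
Qed.

(** Were [g] affine near a point of the ray of [r] close to [tau], its gradient would equal both
    vertices at [r], and the jump would vanish. *)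
Lemma nonlinear_covers_rays (R : realType) (g : 'rV[R]_2 -> R)
    (tau : 'rV[R]_2) (B L : seq 'rV[R]_2) :
  tangent_exponents g tau B -> nonlinear_locus g = ray_union tau L ->
  covers_rays L B.
Proof.
move=> tB locE r r0 rj; have [B0 _] := tB.
have Nn0 : -1 != 0 :> R by rewrite oppr_eq0 oner_neq0.
have [t [t0 h1 h2]] :=
  right_witness2 (sector tB (oner_neq0 R) r0) (sector tB Nn0 r0).
have : nonlinear_locus g (tau + t *: r).
  move=> [u [c hc]].
  suff eu s : (\forall y \near tau + t *: r, 0 <= dot (y - tau) (rot s r) ->
      g y = g tau + dot (vertex B s r) (y - tau)) -> u = vertex B s r.
    by move: rj; rewrite jump_gt0// -(eu _ h1) -(eu _ h2) eqxx.
  move=> hs; apply/eqP; rewrite -subr_eq0; apply/eqP; set w := u - _.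
  apply: (@half_space_eq0 _ _ w (rot s r) (tau + t *: r)
            (g tau - dot u tau - c - dot w (t *: r))).
  apply: filterS2 hc hs => y hy {}hs yq.
  rewrite dot_rot_shift in yq; have := hs yq.
  by rewrite hy !(dotBr, dotDr) !dotBl; lra.
rewrite locE => -[v vL [c /= c0 /addrI e]]; exists v => //; exists (c / t).
  rewrite divr_gt0// lt0r c0 andbT; apply: contra r0 => /eqP c00.
  move: e; rewrite c00 scale0r => /esym/eqP.
  by rewrite scaler_eq0 gt_eqF.
by rewrite mulrC -scalerA e scalerA mulVf ?gt_eqF// scale1r.
Qed.

Lemma distinct_rays_of_uniq (R : realType) (tau : 'rV[R]_2)
    (L : seq 'rV[R]_2) :
  0 \notin L -> uniq [seq ray tau v | v <- L] -> distinct_rays L.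
Proof.
move=> L0 uL; split=> // [|v w vL wL [c c0 wE]]; first exact: map_uniq uL.
suff rE : ray tau v = ray tau w.
  have := nth_uniq set0 _ _ uL; rewrite size_map => /(_ (index v L) (index w L)).
  rewrite !index_mem => /(_ vL wL); rewrite !(nth_map 0) ?index_mem//.
  rewrite !nth_index// rE eqxx => /esym/eqP ie.
  by rewrite -(nth_index 0 vL) ie nth_index.
rewrite wE; apply/seteqP; split=> _ [t /= t0 <-].
  exists (t / c); first by rewrite /= divr_ge0// ltW.
  by rewrite scalerA divfK// gt_eqF.
exists (t * c); first by rewrite /= mulr_ge0// ltW.
by rewrite scalerA.
Qed.

(** Keeps from a positive weight all but its value. Concave faces are treated as convex faces of the
    opposite function. *)
Definition convex_face (R : realType) d (phi : 'rV[R]_d -> R) (x : 'rV[R]_d) :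
    Prop :=
  Defs.locally_convex phi x /\ exists u1 u2, separates phi x u1 u2.

(** The remaining cases, minus a norm and the default value 0, are not positive. *)
Lemma weight_gt0 (R : realType) d (phi : 'rV[R]_d -> R) (x : 'rV[R]_d) :
  0 < weight phi x -> convex_face phi x.
Proof.
rewrite /weight; case: xgetP => [w -> [u1 [u2 [sep [[cvx _] _|[_ ->]]]]]|].
- by split=> //; exists u1, u2.
- by rewrite oppr_gt0 ltNge sqrtr_ge0.
- by rewrite ltxx.
Qed.

Lemma separatesN (R : realType) d (phi : 'rV[R]_d -> R)
    (x u1 u2 : 'rV[R]_d) :
  separates phi x u1 u2 -> separates (fun y => - phi y) x (- u1) (- u2).
Proof.
move=> [u12 [nu nu0 hn]]; split; first by move=> /oppr_inj.
exists nu => //; apply: filterS hn => y [h1 h2].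
by split=> [/h1|/h2] ->; rewrite opprD dotNl.
Qed.

Lemma weight_lt0 (R : realType) d (phi : 'rV[R]_d -> R) (x : 'rV[R]_d) :
  weight phi x < 0 -> convex_face (fun y => - phi y) x.
Proof.
rewrite /weight; case: xgetP => [w -> [u1 [u2 [sep [[_ ->]|[cvx _] _]]]]|].
- by rewrite ltNge sqrtr_ge0.
- by split=> //; exists (- u1), (- u2); exact: separatesN.
- by rewrite ltxx.
Qed.

Lemma locally_convex_midpoint (R : realType) d (phi : 'rV[R]_d -> R)
    (x z : 'rV[R]_d) : Defs.locally_convex phi x ->
  \forall t \near 0^'+, 2 * phi x <= phi (x + t *: z) + phi (x - t *: z).
Proof.
move=> [e e0 cvx].
have bx : \forall y \near x, ball x e y by exact: nbhsx_ballx.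
apply: filterS2 (near_ray z bx) (near_ray (- z) bx) => t.
move=> /nbhs_singleton /= h1 /nbhs_singleton /=; rewrite scalerN => h2.
have p0 : 0 <= 2^-1 :> R by lra.
have p1 : 2^-1 <= 1 :> R by lra.
have := cvx (Itv01 p0 p1) _ _ (mem_set h1) (mem_set h2); rewrite convRE.
rewrite {1}/conv /= /unstable.onem.
have -> : 2^-1 *: (x + t *: z) + (1 - 2^-1) *: (x - t *: z) = x.
  by apply/rowP => i; rewrite !mxE; field.
lra.
Qed.

Lemma min_midpoint (R : realType) (a b a1 b1 a2 b2 : R) :
  a1 + a2 = 2 * a -> b1 + b2 = 2 * b ->
  Num.min a1 b1 + Num.min a2 b2 <= 2 * Num.min a b.
Proof.
by move=> ? ?; case: (leP a1 b1); case: (leP a2 b2); case: (leP a b); lra.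
Qed.

(* Were the jump of phi non-positive, phi would be concave near the points of
   the ray close to tau, so no point there could be on a convex face. *)
Lemma convex_face_jump (R : realType) (g h : 'rV[R]_2 -> R)
    (tau : 'rV[R]_2) (Bg Bh : seq 'rV[R]_2) (v : 'rV[R]_2) :
  tangent_exponents g tau Bg -> tangent_exponents h tau Bh -> v != 0 ->
  (forall t, 0 < t ->
     closure [set x | convex_face (fun y => g y - h y) x] (tau + t *: v)) ->
  jump Bh v < jump Bg v.
Proof.
move=> tBg tBh v0 clo; rewrite ltNge; apply/negP => hj.
have Nn0 : -1 != 0 :> R by rewrite oppr_eq0 oner_neq0.
have [t [t0 h1 h2]] := right_witness2 (sector_sub tBg tBh (oner_neq0 R) v0)
  (sector_sub tBg tBh Nn0 v0).
set p := vertex Bg 1 v - vertex Bh 1 v in h1.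
set m := vertex Bg (-1) v - vertex Bh (-1) v in h2.
pose phi y := g y - h y.
(* As the jump is nonpositive, each of [p] and [m] gives the smaller value on its own side of the
   ray. *)
have hphi : \forall y \near tau + t *: v,
    phi y = phi tau + Num.min (dot p (y - tau)) (dot m (y - tau)).
  apply: filterS2 h1 h2 => y.
  have pmv : dot (p - m) v = 0.
    have [Bg0 _] := tBg; have [Bh0 _] := tBh.
    rewrite !dotBl (vertex_ray 1 (-1) v Bg0) (vertex_ray 1 (-1) v Bh0).
    by rewrite subrr.
  have pmq : dot (p - m) (rot 1 v) <= 0.
    by move: hj; rewrite /jump !dotBl; lra.
  have := frameE 1 v (p - m) (y - tau); rewrite pmv mul0r mulr0 add0r => e.
  have vv := frame_gt0 (oner_neq0 R) v0.
  rewrite rotN dotNr oppr_ge0 -/phi => hp hm.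
  have [yq|yq] := leP 0 (dot (y - tau) (rot 1 v)).
    rewrite min_l; first exact: hp.
    by rewrite -subr_le0 -dotBl -(pmulr_rle0 _ vv) e mulr_le0_ge0.
  rewrite min_r; first exact: hm (ltW yq).
  by rewrite -subr_ge0 -dotBl -(pmulr_rge0 _ vv) e mulr_le0// ltW.
(* The closure provides a convex-face point [y] so close to the ray that the minimum formula still
   holds around it. *)
have [y [[cvx [u1 [u2 [u12 [nu nu0 sep]]]]] hy]] := clo t t0 _ (near_join hphi).
apply: u12; apply/eqP; rewrite -subr_eq0; apply/eqP/dot_separating.
suff half z : 0 <= dot nu z -> dot (u1 - u2) z = 0.
  move=> z; have [/half//|zq] := leP 0 (dot nu z).
  by apply/eqP; rewrite -oppr_eq0 -dotNr half// dotNr oppr_ge0 ltW.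
move=> nuz.
have /= cv := locally_convex_midpoint z cvx.
have hys : \forall w \near y,
    phi w = phi tau + Num.min (dot p (w - tau)) (dot m (w - tau)) /\
    ((0 <= dot nu (w - y) -> phi w = phi y + dot u1 (w - y)) /\
     (dot nu (w - y) <= 0 -> phi w = phi y + dot u2 (w - y))).
  exact: filterI.
have mid : \forall e \near 0^'+,
    phi (y + e *: z) = phi tau +
      Num.min (dot p (y + e *: z - tau)) (dot m (y + e *: z - tau)) /\
    phi (y + e *: z) = phi y + dot u1 (e *: z).
  apply: filterS2 (nbhs_right_gt (0 : R)) (near_ray z hys) => e e0.
  move=> /nbhs_singleton [/= e1 [e2 _]]; split; first exact: e1.
  move: e2.
  have -> : y + e *: z - y = e *: z by rewrite addrC addKr.
  by apply; rewrite dotZr mulr_ge0// ltW.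
have mid' : \forall e \near 0^'+,
    [/\ phi (y - e *: z) = phi tau +
          Num.min (dot p (y - e *: z - tau)) (dot m (y - e *: z - tau)),
        phi (y - e *: z) = phi y - dot u2 (e *: z)
      & 2 * phi y <= phi (y + e *: z) + phi (y - e *: z)].
  apply: filterS3 (nbhs_right_gt (0 : R)) (near_ray (- z) hys) cv => e e0.
  rewrite scalerN => /nbhs_singleton [/= e1 [_ e2]] e3.
  split; [exact: e1| |exact: e3].
  move: e2.
  have -> : y - e *: z - y = - (e *: z) by rewrite addrC addKr.
  by rewrite !dotNr; apply; rewrite oppr_le0 dotZr mulr_ge0// ltW.
have [e [e0 [p1 p2] [m1 m2 ce]]] := right_witness2 mid mid'.
have /= y1 := nbhs_singleton hy.
have sym w : dot w (y + e *: z - tau) + dot w (y - e *: z - tau)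
    = 2 * dot w (y - tau).
  rewrite -dotDr -dotZr; congr (dot _ _).
  by apply/rowP => i; rewrite !mxE; ring.
have := min_midpoint (sym p) (sym m) => conc.
(* Concavity of the minimum gives one inequality, midpoint convexity at [y] the other. *)
have : dot u1 (e *: z) - dot u2 (e *: z) = 0.
  apply/eqP; rewrite eq_le; apply/andP; split.
    have -> : dot u1 (e *: z) - dot u2 (e *: z) =
        phi (y + e *: z) + phi (y - e *: z) - 2 * phi y by rewrite p2 m2; ring.
    by rewrite p1 m1 y1; move: conc; lra.
  have -> : dot u1 (e *: z) - dot u2 (e *: z) =
      phi (y + e *: z) + phi (y - e *: z) - 2 * phi y by rewrite p2 m2; ring.
  by rewrite subr_ge0.
rewrite -dotBl dotZr => /eqP.
by rewrite mulf_eq0 gt_eqF//= => /eqP.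
Qed.

(** * Comparison of two representations *)

Lemma distinct_rays_cons (R : realType) (v : 'rV[R]_2) (L : seq 'rV[R]_2) :
  v != 0 -> distinct_rays L -> (forall w, w \in L -> ~ same_ray w v) ->
  distinct_rays (v :: L).
Proof.
move=> v0 [uL L0 Li] nv; split.
- rewrite /= uL andbT; apply/negP => /nv; apply.
  by exists 1; rewrite ?ltr01// scale1r.
- by rewrite in_cons negb_or eq_sym v0.
- move=> a b; rewrite !in_cons => /orP[/eqP ->|aL] /orP[/eqP ->|bL] //.
  + by move=> /same_ray_sym /(nv _ bL).
  + by move=> /(nv _ aL).
  + exact: Li.
Qed.

(** Apart from the last two inequalities, [g] and [h] enter symmetrically, so exchanging them covers
    the other case of minimality. *)
Lemma no_improvement (R : realType) (tau : 'rV[R]_2)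
    (g h g' h' : 'rV[R]_2 -> R) (Bg Bh : seq 'rV[R]_2)
    (vs ws extra : seq 'rV[R]_2) :
  tropical_polynomial g -> tropical_polynomial h ->
  tropical_polynomial g' -> tropical_polynomial h' ->
  (forall x, g x - h x = g' x - h' x) ->
  tangent_exponents g tau Bg -> tangent_exponents h tau Bh ->
  distinct_rays vs -> (forall v, v \in vs -> jump Bh v < jump Bg v) ->
  distinct_rays ws -> (forall w, w \in ws -> jump Bg w < jump Bh w) ->
  0 \notin extra -> (size extra <= 1)%N ->
  nonlinear_locus g = ray_union tau (vs ++ extra) ->
  nonlinear_locus h = ray_union tau (ws ++ extra) ->
  (mComp g' < mComp g)%N -> (mComp h' <= mComp h)%N -> False.
Proof.
move=> tg th tg' th' e tBg tBh dvs vsj dws wsj ex0 ex1 locg loch lt_g le_h.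
have [Bg' tBg'] := tangent_exists tau tg'.
have [Bh' tBh'] := tangent_exists tau th'.
have [Bg0 _] := tBg; have [Bh0 _] := tBh.
have [Bg'0 _] := tBg'; have [Bh'0 _] := tBh'.
have js v : v != 0 -> jump Bg v - jump Bh v = jump Bg' v - jump Bh' v.
  by move=> v0; exact: jump_sub tBg tBh tBg' tBh' e v0.
have [uvs vs0 vsi] := dvs; have [uws ws0 wsi] := dws.
have vsj' v : v \in vs -> 0 < jump Bg' v.
  move=> vL; have := js v (neq0_in vs0 vL); have := vsj v vL.
  by have := jump_ge0 v Bh'0; lra.
have wsj' w : w \in ws -> 0 < jump Bh' w.
  move=> wL; have := js w (neq0_in ws0 wL); have := wsj w wL.
  by have := jump_ge0 w Bg'0; lra.
have g'_ge : (size vs <= mComp g')%N by exact: mComp_ge_rays tg' tBg' dvs vsj'.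
have g'_gt0 := mComp_gt0 tg'.
have ub (f : 'rV[R]_2 -> R) B L L' : tropical_polynomial f ->
    tangent_exponents f tau B -> nonlinear_locus f = ray_union tau L ->
    0 \notin L' -> covers_rays L' B -> (mComp f <= maxn 1 (size L'))%N.
  move=> tf tB locE; apply: (mComp_le_rays tf tB) => x t t0; rewrite locE.
  exact: ray_union_conic.
have covg := nonlinear_covers_rays tBg locg.
have covh := nonlinear_covers_rays tBh loch.
(* Otherwise [g] would have at most [maxn 1 (size vs)] regions, hence no more than [g']. *)
have ncov : ~ covers_rays vs Bg.
  move=> /(ub _ _ _ _ tg tBg locg vs0); rewrite leq_max.
  move=> /orP[]/(leq_trans lt_g); rewrite ltnNge; first by rewrite g'_gt0.
  by rewrite g'_ge.
have [v0 exE] : exists v0, extra = [:: v0].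
  case: extra ex1 {ex0 locg loch covh} covg => [|v0 [|//]] _ covg; last by exists v0.
  by case: ncov; rewrite cats0 in covg.
rewrite {extra ex1}exE inE eq_sym in ex0 locg loch covg covh.
have nv0 v : v \in vs -> ~ same_ray v v0.
  move=> vL vv0; apply: ncov => r r0 /(covg r r0) [w].
  rewrite mem_cat inE => /orP[wL|/eqP ->] wr; first by exists w.
  by exists v => //; exact: same_ray_trans wr.
have dL : distinct_rays (v0 :: vs) by exact: distinct_rays_cons.
have covg1 : covers_rays (v0 :: vs) Bg.
  move=> r r0 /(covg r r0) [w wL wr]; exists w => //.
  by move: wL; rewrite mem_cat !inE orbC.
have g_le : (mComp g <= (size vs).+1)%N.
  have [_ L0 _] := dL; have := ub _ _ _ _ tg tBg locg L0 covg1.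
  by rewrite (maxn_idPr _).
have h_le : (mComp h <= (size ws).+1)%N.
  have L0 : 0 \notin ws ++ [:: v0] by rewrite mem_cat inE negb_or ws0 eq_sym.
  by have := ub _ _ _ _ th tBh loch L0 covh; rewrite size_cat addn1 (maxn_idPr _).
(* A further ray would give [g'] at least [(size vs).+1] regions, which is already the upper bound
   for [g]. *)
have covg' : covers_rays vs Bg'.
  move=> r r0 rj; apply: contrapT => nr.
  have dr : distinct_rays (r :: vs).
    by apply: distinct_rays_cons => // w wL wr; apply: nr; exists w.
  have := mComp_ge_rays tg' tBg' dr; rewrite /= => lb.
  have := leq_trans lt_g g_le; rewrite ltnS leqNgt => /negP; apply.
  by apply: lb => w; rewrite in_cons => /orP[/eqP ->|/vsj'].
have v0j : 0 < jump Bg v0.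
  rewrite lt0r jump_ge0// andbT; apply/eqP => v0j; apply: ncov.
  move=> r r0 rj; have [w] := covg r r0 rj.
  rewrite mem_cat inE => /orP[wL|/eqP ->]; first by exists w.
  by move=> [c c0 rE]; move: rj; rewrite rE jumpZ// v0j mulr0 ltxx.
have v0j' : jump Bg' v0 = 0.
  apply/eqP; apply: contraT => k; have : 0 < jump Bg' v0 by rewrite lt0r k jump_ge0.
  by move=> /(covg' _ ex0) [v /nv0].
have opp v w : v \in vs -> w \in ws -> ~ same_ray w v.
  move=> vL wL [c c0 vE]; have := vsj v vL; have := wsj w wL.
  have w0 := neq0_in ws0 wL.
  by rewrite vE !jumpZ// ltr_pM2l// => /lt_trans h1 /h1; rewrite ltxx.
(* The rays of [h] are generated by elements of [ws] or by [v0], none of which lies on a ray of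
   [vs]. *)
have vsh v : v \in vs -> jump Bh v = 0.
  move=> vL; apply/eqP; apply: contraT => k.
  have : 0 < jump Bh v by rewrite lt0r k jump_ge0.
  move=> /(covh _ (neq0_in vs0 vL)) [w]; rewrite mem_cat inE.
  move=> /orP[/(opp _ _ vL)//|/eqP -> /same_ray_sym].
  by move=> /(nv0 _ vL).
(* Two such rays besides those of [ws] would give [h'] at least [(size ws).+2] regions, whereas [h]
   has at most [(size ws).+1]. *)
have one v w : v \in vs -> w \in vs -> 0 < jump Bh' v -> 0 < jump Bh' w -> v = w.
  move=> vL wL vj wj; apply/eqP; apply: contraT => vw.
  have d2 : distinct_rays [:: v, w & ws].
    apply: distinct_rays_cons; first exact: neq0_in vL.
      by apply: distinct_rays_cons => [|//|a aL]; [exact: neq0_in wL|exact: opp].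
    move=> a; rewrite in_cons => /orP[/eqP ->|aL]; last exact: opp.
    by move=> /(vsi _ _ wL vL) wv; rewrite wv eqxx in vw.
  have := mComp_ge_rays th' tBh' d2; rewrite /= => lb.
  have := leq_trans le_h h_le; rewrite leqNgt => /negP; case.
  by apply: lb => a; rewrite !in_cons => /or3P[/eqP ->|/eqP ->|/wsj'].
(* Difference of the balancing identities of [g] and [g']: on [vs], where [jump Bh] vanishes, the
   jump of [g'] exceeds that of [g] by [jump Bh']. *)
have bal : (jump Bg v0 / dot v0 v0) *: v0 =
    \sum_(v <- vs) (jump Bh' v / dot v v) *: v.
  have := jump_balancing Bg0 dL covg1; rewrite big_cons => /eqP.
  rewrite addr_eq0 -sumrN => /eqP ->.
  rewrite -[LHS]addr0 -[X in _ + X](jump_balancing Bg'0 dvs covg') -big_split.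
  apply: eq_big_seq => v vL /=; rewrite -scaleNr -scalerDl; congr (_ *: _).
  rewrite -mulNr -mulrDl; congr (_ / _).
  by have := js v (neq0_in vs0 vL); rewrite vsh//; lra.
have k0 : 0 < jump Bg v0 / dot v0 v0 by rewrite divr_gt0 ?dot_gt0.
(* By [one], at most one term of the sum is nonzero, so [v0] would lie on a ray of [vs] or
   vanish. *)
have [[v1 v1L v1j]|nex] := pselect (exists2 v, v \in vs & 0 < jump Bh' v).
  move: bal; rewrite (bigD1_seq v1)//= big1_seq => [|v /andP[vv1 vL]].
    rewrite addr0 => bal; apply: (nv0 _ v1L).
    have k1 : 0 < jump Bh' v1 / dot v1 v1.
      by rewrite divr_gt0 ?dot_gt0// (neq0_in vs0).
    exists ((jump Bg v0 / dot v0 v0)^-1 * (jump Bh' v1 / dot v1 v1)).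
      by rewrite mulr_gt0// invr_gt0.
    by rewrite -scalerA -bal scalerA mulVf ?gt_eqF// scale1r.
  have -> : jump Bh' v = 0; last by rewrite mul0r scale0r.
  apply/eqP; apply: contraT => vj.
  by rewrite (one v v1 vL v1L _ v1j) ?eqxx// lt0r vj jump_ge0 in vv1.
move: bal; rewrite big1_seq => [|v /andP[_ vL]].
  by move=> /eqP; rewrite scaler_eq0 (negPf ex0) gt_eqF.
have -> : jump Bh' v = 0; last by rewrite mul0r scale0r.
apply/eqP; apply: contraT => vj; case: nex; exists v => //.
by rewrite lt0r vj jump_ge0.
Qed.

Theorem proposition1 (R : realType) (phi : 'rV[R]_2 -> R) (tau : 'rV[R]_2)
    (hphi : conewise_linear tau phi)
    (g h : 'rV[R]_2 -> R)
    (hgh : canonical_representation tau phi g h) :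
  minimal_representation phi g h.
Proof.
case: hgh => rep [vs [ws]] /=; set v0 := - _; set extra := if _ then _ else _.
move=> [[uvs [vs0 posE _]] [uws [ws0 negE _]] [gn0 locg _] [_ loch _]].
split=> //; case=> g' [h' [[tg' th' phiE'] le_g le_h lt]].
have [tg th phiE] := rep.
have ex0 : 0 \notin extra by move: gn0; rewrite mem_cat negb_or => /andP[].
have ex1 : (size extra <= 1)%N by rewrite /extra; case: ifP.
have [Bg tBg] := tangent_exists tau tg.
have [Bh tBh] := tangent_exists tau th.
have phi_gh : phi = fun y => g y - h y by apply/funext.
(* The negative part of [phi] is handled through the convex faces of [h - g]. *)
have phi_hg : (fun y => - phi y) = fun y => h y - g y.
  by apply/funext => y; rewrite phiE opprB.
have rayP v t : 0 < t -> ray tau v (tau + t *: v) by exists t => //; exact: ltW.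
have vsj v : v \in vs -> jump Bh v < jump Bg v.
  move=> vL; apply: (convex_face_jump tBg tBh (neq0_in vs0 vL)) => t t0.
  have : positive_part phi (tau + t *: v) by rewrite posE; exists v => //; exact: rayP.
  by apply: closureS => x /=; rewrite -phi_gh; exact: weight_gt0.
have wsj w : w \in ws -> jump Bg w < jump Bh w.
  move=> wL; apply: (convex_face_jump tBh tBg (neq0_in ws0 wL)) => t t0.
  have : negative_part phi (tau + t *: w) by rewrite negE; exists w => //; exact: rayP.
  by apply: closureS => x /=; rewrite -phi_hg; exact: weight_lt0.
have dvs := distinct_rays_of_uniq vs0 uvs.
have dws := distinct_rays_of_uniq ws0 uws.
case: lt => lt.
  apply: (no_improvement tg th tg' th' _ tBg tBh dvs vsj dws wsj ex0 ex1 locg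
    loch lt le_h) => x.
  by rewrite -phiE phiE'.
apply: (no_improvement th tg th' tg' _ tBh tBg dws wsj dvs vsj ex0 ex1 loch
  locg lt le_g) => x.
by rewrite -opprB -phiE phiE' opprB.
Qed.
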